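(* Let $n\ge 1$ be an integer, and let $p,\alpha,\lambda$ be real numbers such that either ($p>1$ and $0<\alpha<\frac{n+2}{2p}$) or ($p=1$ and $0<\alpha\le\frac{n+2}{2p}$), and such that $\lambda\ge 1$ and $\alpha>\frac{n+2}{2p}\left(1-\frac1\lambda\right)$. Suppose $u\in Y^p_\alpha$ satisfies $$0\le(\partial_t-\Delta)^\alpha u\le u^\lambda\quad\text{in }\mathbb{R}^n\times\mathbb{R},\qquad u=0\quad\text{in }\mathbb{R}^n\times(-\infty,0).$$ Then $$u=(\partial_t-\Delta)^\alpha u=0\quad\text{almost everywhere in }\mathbb{R}^n\times\mathbb{R}.$$
   Context: For $\alpha>0$ and $(x,t)\in\mathbb{R}^n\times\mathbb{R}$ let $$\Phi_\alpha(x,t)=\frac{t^{\alpha-1}}{\Gamma(\alpha)}\frac{1}{(4\pi t)^{n/2}}e^{-|x|^2/(4t)}\chi_{(0,\infty)}(t)$$ and $$J_\alpha f(x,t)=\iint_{\mathbb{R}^n\times(-\infty,t)}\Phi_\alpha(x-\xi,t-\tau)f(\xi,\tau)\,d\xi\,d\tau .$$ For $T\in\mathbb{R}$ put $\mathbb{R}_T=(-\infty,T)$. $X^p=\bigcap_{T\in\mathbb{R}}L^p(\mathbb{R}^n\times\mathbb{R}_T)$ is the set of all measurable $f:\mathbb{R}^n\times\mathbb{R}\to\mathbb{R}$ with $\|f\|_{L^p(\mathbb{R}^n\times\mathbb{R}_T)}<\infty$ for all $T\in\mathbb{R}$, and $Y^p_\alpha=J_\alpha(X^p)$. Functions equal almost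 everywhere are identified, and (in)equalities between elements of these spaces are understood almost everywhere. When ($p>1$ and $0<\alpha<\frac{n+2}{2p}$) or ($p=1$ and $0<\alpha\le\frac{n+2}{2p}$), the integral defining $J_\alpha f$ yields a real-valued measurable function for each $f\in X^p$, the operator $J_\alpha:X^p\to Y^p_\alpha$ is one-to-one and onto, and $(\partial_t-\Delta)^\alpha:Y^p_\alpha\to X^p$ is defined to be its inverse. Since $(\partial_t-\Delta)^\alpha u\ge0$ forces $u\ge0$, the power $u^\lambda$ is meaningful. *)

(* Defs.v *)
From HB Require Import structures.
From mathcomp Require Import all_boot all_order all_algebra.
From mathcomp Require Import all_classical all_reals all_analysis.

Set Implicit Arguments.
Unset Strict Implicit.
Unset Printing Implicit Defensive.

Import Order.TTheory GRing.Theory Num.Theory.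
Import numFieldNormedType.Exports.

Local Open Scope classical_set_scope.
Local Open Scope ring_scope.

(* not available through canonical structures: the sigma-finite structure found
   for [m1 \x m2] is the one for subprobability measures *)
Lemma sigma_finite_product_measure1 d1 d2 (T1 : measurableType d1)
    (T2 : measurableType d2) (R : realType)
    (m1 : {sigma_finite_measure set T1 -> \bar R})
    (m2 : {sigma_finite_measure set T2 -> \bar R}) :
  sigma_finite setT (m1 \x m2)%E.
Proof.
have /sigma_finiteP[F [TF ndF Foo]] := sigma_finiteT m1.
have /sigma_finiteP[G [TG ndG Goo]] := sigma_finiteT m2.
exists (fun n => F n `*` G n).
  rewrite -setXTT TF TG predeqE => -[x y]; split.
    move=> [/= [n _ Fnx] [k _ Gky]]; exists (maxn n k) => //; split.
    - by move: x Fnx; exact/subsetPset/ndF/leq_maxl.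
    - by move: y Gky; exact/subsetPset/ndG/leq_maxr.
  by move=> [n _ []/= ? ?]; split; exists n.
move=> k; have [? ?] := Foo k; have [? ?] := Goo k.
split; first exact: measurableX.
by rewrite product_measure1E// lte_mul_pinfty// ge0_fin_numE.
Qed.

Section lebesgue_measure_tuple.
Context {R : realType}.

Definition tuple_cons n (x : measurableTypeR R * n.-tuple (measurableTypeR R)) :
    n.+1.-tuple (measurableTypeR R) :=
  [the n.+1.-tuple (measurableTypeR R) of x.1 :: x.2].

Lemma measurable_tuple_cons n : measurable_fun [set: _] (@tuple_cons n).
Proof. exact: measurable_cons. Qed.

Definition tuple_uncons n (y : n.+1.-tuple (measurableTypeR R)) :
    measurableTypeR R * n.-tuple (measurableTypeR R) :=
  (thead y, [tuple of behead y]).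

Lemma tuple_consK n : cancel (@tuple_cons n) (@tuple_uncons n).
Proof. by case=> x t; rewrite /tuple_uncons theadE; congr pair; apply/val_inj. Qed.

Lemma tuple_unconsK n : cancel (@tuple_uncons n) (@tuple_cons n).
Proof. by move=> y; rewrite [RHS](tuple_eta y); apply/val_inj. Qed.

Lemma measurable_tuple_uncons n : measurable_fun [set: _] (@tuple_uncons n).
Proof.
by apply: measurable_fun_pair; [exact: measurable_tnth|exact: measurable_behead].
Qed.

Section step.
Local Open Scope ereal_scope.
Variable n : nat.
Variable m : {sigma_finite_measure set (n.-tuple (measurableTypeR R)) -> \bar R}.

Definition lebesgue_tuple_cons :
    set (n.+1.-tuple (measurableTypeR R)) -> \bar R :=
  pushforward (@lebesgue_measure R \x m) (@tuple_cons n).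

Let lebesgue_tuple_cons0 : lebesgue_tuple_cons set0 = 0.
Proof. by rewrite /lebesgue_tuple_cons /pushforward preimage_set0 measure0. Qed.

Let lebesgue_tuple_cons_ge0 A : 0 <= lebesgue_tuple_cons A.
Proof. by rewrite /lebesgue_tuple_cons /pushforward; exact: measure_ge0. Qed.

Let measurable_preimage (A : set (n.+1.-tuple (measurableTypeR R))) :
  measurable A -> measurable (@tuple_cons n @^-1` A).
Proof. by move=> mA; rewrite -[X in measurable X]setTI; exact: measurable_tuple_cons. Qed.

Let lebesgue_tuple_cons_sigma_additive :
  semi_sigma_additive lebesgue_tuple_cons.
Proof.
move=> F mF tF mUF; rewrite /lebesgue_tuple_cons /pushforward preimage_bigcup.
apply: measure_semi_sigma_additive.
- by move=> k; exact: measurable_preimage.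
- apply/trivIsetP => /= i j _ _ ij; rewrite -preimage_setI.
  by move/trivIsetP : tF => /(_ _ _ _ _ ij) ->//; rewrite preimage_set0.
- by rewrite -preimage_bigcup; exact: measurable_preimage.
Qed.

HB.instance Definition _ := isMeasure.Build _ _ _ lebesgue_tuple_cons
  lebesgue_tuple_cons0 lebesgue_tuple_cons_ge0
  lebesgue_tuple_cons_sigma_additive.

Let lebesgue_tuple_cons_sigma_finite : sigma_finite setT lebesgue_tuple_cons.
Proof.
have [F TF Foo] := sigma_finite_product_measure1 (@lebesgue_measure R) m.
exists (fun i => @tuple_uncons n @^-1` F i).
  by rewrite -preimage_bigcup -TF preimage_setT.
move=> i; have [mFi Fioo] := Foo i; split.
  by rewrite -[X in measurable X]setTI; exact: measurable_tuple_uncons.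
rewrite /lebesgue_tuple_cons /pushforward -comp_preimage.
by rewrite (_ : _ \o _ = id)//; apply/funext => x /=; rewrite tuple_consK.
Qed.

HB.instance Definition _ := Measure_isSigmaFinite.Build _ _ _
  lebesgue_tuple_cons lebesgue_tuple_cons_sigma_finite.

End step.

(* n-dimensional Lebesgue measure: the n-fold product of [lebesgue_measure],
   transported along [tuple_cons] *)
Fixpoint lebesgue_tuple (n : nat) :
    {sigma_finite_measure set (n.-tuple (measurableTypeR R)) -> \bar R} :=
  match n with
  | 0 => \d_([tuple] : 0.-tuple (measurableTypeR R))
  | k.+1 => lebesgue_tuple_cons (lebesgue_tuple k)
  end.

End lebesgue_measure_tuple.
Arguments lebesgue_tuple R n : clear implicits.

(* points of R^n x R, as pairs (x, t) *)
Notation spacetime R n :=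
  (n.-tuple (measurableTypeR R) * measurableTypeR R)%type.

Section spacetime_measure.
Variables (R : realType) (n : nat).

Definition spacetime_measure : set (spacetime R n) -> \bar R :=
  (lebesgue_tuple R n \x @lebesgue_measure R)%E.

HB.instance Definition _ := Measure.on spacetime_measure.
HB.instance Definition _ := Measure_isSigmaFinite.Build _ _ _
  spacetime_measure (sigma_finite_product_measure1 _ _).

End spacetime_measure.
Arguments spacetime_measure R n : clear implicits.

Section fractional_heat_operator.
Context {R : realType} {n : nat}.
Implicit Types (alpha p T : R) (f u : spacetime R n -> R).
Local Notation mu := (spacetime_measure R n).

Definition Gamma (a : R) : R :=
  \int[@lebesgue_measure R]_(s in `]0, +oo[) (s `^ (a - 1) * expR (- s)).

Definition sqnorm (x : n.-tuple R) : R := \sum_(i < n) tnth x i ^+ 2.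

Definition tuple_sub (x y : n.-tuple R) : n.-tuple R :=
  [tuple tnth x i - tnth y i | i < n].

Definition Phi alpha (x : n.-tuple R) (t : R) : R :=
  t `^ (alpha - 1) / Gamma alpha * ((4 * pi * t) `^ (n%:R / 2))^-1
  * expR (- (sqnorm x / (4 * t))) * \1_(`]0, +oo[) t.

Definition past T : set (spacetime R n) := [set z | (z.2 : R) < T].

(* Being a [Rintegral], J alpha f z is 0 at the points z where the integral is
   not finite; under the assumptions relating n, p and alpha, such points form
   a null set for f in Xspace p. *)
Definition J alpha f (z : spacetime R n) : R :=
  \int[mu]_(w in past z.2) (Phi alpha (tuple_sub z.1 w.1) (z.2 - w.2) * f w).

(* The spaces below consist of functions, not of classes of functions: equality
   almost everywhere is kept explicit. *)
Definition Xspace p : set (spacetime R n -> R) :=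
  [set f : spacetime R n -> R | measurable_fun [set: _] f /\
    forall T, finite_norm mu p%:E (f \* \1_(past T))].

Definition Yspace alpha p : set (spacetime R n -> R) :=
  [set u | exists2 f, Xspace p f & u = J alpha f %[ae mu]].

(* The operator (d_t - Laplacian)^alpha : Yspace alpha p -> Xspace p, inverse of
   J alpha. As J alpha is one-to-one on Xspace p modulo equality almost
   everywhere, [xget] picks a representative of the only possible class; the
   default value 0 is used only outside of Yspace alpha p. *)
Definition fheat alpha p u : spacetime R n -> R :=
  xget (cst 0) [set f | Xspace p f /\ u = J alpha f %[ae mu]].

End fractional_heat_operator.

(* Main.v *)
Require Import Defs.
From mathcomp Require Import all_boot all_order all_algebra.
From mathcomp Require Import all_classical all_reals all_analysis.
From mathcomp Require Import measurable_realfun ring lra.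

Import Order.TTheory GRing.Theory Num.Theory.
Import numFieldNormedType.Exports.

Local Open Scope classical_set_scope.
Local Open Scope ring_scope.

(** Let f be the fractional heat operator applied to u, so that u = J f and
    0 <= f <= (J f)^lambda almost everywhere. The proof bounds f by itself, on
    short time slabs and with a constant smaller than 1.

    Suppose that f vanishes before time T0. For points z and w of the slab of
    times between T0 and T0 + eps, only the part of the kernel Phi of J with
    time lag at most eps contributes to J f (z) (heat_potential_le_slab). Let
    1/r = 1 - 1/p + 1/(lambda p). Integrating the Gaussian in space and a power
    of t in time gives
      || Phi 1_(0 < t <= eps) ||_r^r <= D eps^beta,
      beta = r (alpha - (n+2)/(2p) (1 - 1/lambda)),
    and the hypothesis on alpha says exactly that beta > 0, so that this norm
    tends to 0 with eps. Young's convolution inequality maps L^p to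
    L^(lambda p), and the pointwise inequality f <= (J f)^lambda brings us back
    to L^p: with N the integral of f^p over times before T0 + eps, and a any
    bound for the r-th power of the kernel norm,
      N <= a^((p-1) lambda + 1) N^(lambda-1) N
    (young_integral_operator). Now N is at most M, the integral of f^p over all
    times before a fixed T, which is finite as f is in X^p. Hence if eps is
    small in terms of T only, the factor in front of N is less than 1 and
    N = 0 (vanishing_step). Since eps does not depend on T0, finitely many steps
    starting from T0 = 0 show that f vanishes before T (vanishing_slabs), and T
    is arbitrary; finally u = J 0 = 0.

    Since f >= 0, the integrals defining J f can be handled as extended
    nonnegative numbers: where such an integral is infinite, J f is 0 by
    convention, f is then 0 as well, and the inequality f <= (J f)^lambda
    remains true with +oo on the right. *)

(** * Young's inequality for integral operators *)

(** Jensen's inequality for t^p with respect to the weight w of total mass at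
    most W. For p > 1 it is Hoelder's inequality for the factorization
    w h = (w^(1/p) h) w^(1/q). *)
Lemma power_mean_integral d (T : measurableType d) (R : realType)
    (mu : {measure set T -> \bar R}) (p W : R) (w h : T -> R) :
  1 <= p -> 0 <= W ->
  measurable_fun [set: T] w -> measurable_fun [set: T] h ->
  (forall x, 0 <= w x) -> (forall x, 0 <= h x) ->
  (\int[mu]_x (w x)%:E <= W%:E)%E ->
  ((\int[mu]_x (w x * h x)%:E) `^ p <=
    (W `^ (p - 1))%:E * \int[mu]_x (w x * h x `^ p)%:E)%E.
Proof.
move=> p1 W0 mw mh w0 h0 wW.
have int0 (k : T -> R) : (forall x, 0 <= k x) -> (0 <= \int[mu]_x (k x)%:E)%E.
  by move=> k0; apply: integral_ge0 => x _; rewrite lee_fin.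
have wh0 x : 0 <= w x * h x by rewrite mulr_ge0.
have p0 : 0 < p by lra.
have [->|pN1] := eqVneq p 1.
  rewrite subrr powRr0 mul1e poweRe1; last exact: int0.
  by rewrite [leRHS](eq_integral (fun x => (w x * h x)%:E)) // => x _; rewrite powRr1.
have p1' : 1 < p by rewrite lt_neqAle eq_sym pN1.
pose q := p / (p - 1).
have q0 : 0 < q by rewrite divr_gt0// subr_gt0.
have pq : p^-1 + q^-1 = 1.
  rewrite /q invfM invrK; field; lra.
pose f1 x := w x `^ p^-1 * h x.
pose f2 x := w x `^ q^-1.
have mf2 : measurable_fun [set: T] f2.
  by apply: (measurableT_comp (measurable_powR _)).
have mf1 : measurable_fun [set: T] f1.
  apply: measurable_funM => //.
  by apply: (measurableT_comp (measurable_powR _)).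
have f10 x : 0 <= f1 x by rewrite mulr_ge0 ?powR_ge0.
have f1f2 x : f1 x * f2 x = w x * h x.
  rewrite /f1 /f2 mulrAC -powRD ?pq ?powRr1//.
  by rewrite oner_eq0.
have := hoelder mu mf1 mf2 p0 q0 pq.
rewrite Lnorm1 => H.
have {}H := gt0_ler_poweR (ltW p0) _ _ H.
have e1 : (\int[mu]_x `|(EFin \o (f1 \* f2)%R) x| = \int[mu]_x (w x * h x)%:E)%E.
  by apply: eq_integral => x _ /=; rewrite f1f2 ger0_norm.
rewrite e1 in H.
apply: (le_trans (H _ _)); rewrite ?in_itv/= ?leey ?andbT ?int0// ?mule_ge0 ?Lnorm_ge0//.
rewrite poweRM ?Lnorm_ge0// powR_Lnorm ?gt_eqF//.
rewrite unlock -poweRrM muleC.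
have e2 : (\int[mu]_x `|(EFin \o f1) x| `^ p = \int[mu]_x (w x * h x `^ p)%:E)%E.
  apply: eq_integral => x _ /=.
  rewrite ger0_norm// /f1 powRM ?powR_ge0// -powRrM mulVf ?gt_eqF// powRr1//.
have e3 : (\int[mu]_x `|(EFin \o f2) x| `^ q = \int[mu]_x (w x)%:E)%E.
  apply: eq_integral => x _ /=.
  by rewrite ger0_norm ?powR_ge0// -powRrM mulVf ?gt_eqF// powRr1//.
rewrite e2 e3; apply: lee_wpmul2r.
  by apply: int0 => x; rewrite mulr_ge0 ?powR_ge0.
have -> : q^-1 * p = p - 1 by rewrite /q invfM invrK; field; lra.
rewrite -poweR_EFin; apply: gt0_ler_poweR => //; first lra.
  by rewrite in_itv/= leey int0.
by rewrite in_itv/= leey lee_fin W0.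
Qed.

(** Young's inequality, for a kernel whose r-th powers have all their marginal
    integrals bounded by A; convolution kernels are a special case. Splitting
    k = k^r k^(1-r) and using the power mean inequality with weight k^r bounds
    (int k h)^p by A^(p-1) int k^(r/lambda) h^p, since r + p (1 - r) = r/lambda;
    using it again, with weight h^p and exponent lambda, restores k^r, and
    Tonelli's theorem integrates k^r in the first variable. *)
Lemma young_integral_operator d (T : measurableType d) (R : realType)
    (mu : {sigma_finite_measure set T -> \bar R}) (p lambda r A M : R)
    (k : T * T -> R) (h : T -> R) :
  1 <= p -> 1 <= lambda -> 0 < r -> r^-1 = 1 - p^-1 + (lambda * p)^-1 ->
  0 <= A -> 0 <= M ->
  measurable_fun [set: T * T] k -> measurable_fun [set: T] h ->
  (forall x, 0 <= k x) -> (forall x, 0 <= h x) ->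
  (forall z, \int[mu]_w (k (z, w) `^ r)%:E <= A%:E)%E ->
  (forall w, \int[mu]_z (k (z, w) `^ r)%:E <= A%:E)%E ->
  (\int[mu]_w (h w `^ p)%:E <= M%:E)%E ->
  (\int[mu]_z ((\int[mu]_w (k (z, w) * h w)%:E) `^ (lambda * p)) <=
   (A `^ ((p - 1) * lambda + 1) * M `^ (lambda - 1))%:E
     * \int[mu]_w (h w `^ p)%:E)%E.
Proof.
move=> p1 l1 r0 rE A0 M0 mk mh k0 h0 kA1 kA2 hM.
have p0 : 0 < p by lra.
have l0 : 0 < lambda by lra.
have rl : r + p * (1 - r) = r / lambda.
  have : r * r^-1 * (lambda * p) = r * (1 - p^-1 + (lambda * p)^-1) * (lambda * p).
    by rewrite -rE.
  rewrite divff ?gt_eqF// => H.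
  have {H} : lambda * p = r * (lambda * p - lambda + 1).
    rewrite mul1r in H; rewrite {1}H; field; lra.
  move=> H; have lN0 : lambda != 0 by rewrite gt_eqF.
  apply: (mulIf lN0).
  rewrite divfK ?gt_eqF//; lra.
have mk1 z : measurable_fun [set: T] (fun w => k (z, w)).
  by apply: measurableT_comp => //.
have mkr s : measurable_fun [set: T * T] (fun x => k x `^ s).
  by apply: (measurableT_comp (measurable_powR _)).
have mkr1 s z : measurable_fun [set: T] (fun w => k (z, w) `^ s).
  by apply: (measurableT_comp (measurable_powR _)).
have mhr s : measurable_fun [set: T] (fun w => h w `^ s).
  by apply: (measurableT_comp (measurable_powR _)).
have int0 (f : T -> R) : (forall x, 0 <= f x) -> (0 <= \int[mu]_x (f x)%:E)%E.
  by move=> f0; apply: integral_ge0 => x _; rewrite lee_fin.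
pose H := (fun z => \int[mu]_w (h w `^ p * k (z, w) `^ r)%:E)%E.
have mhk : measurable_fun [set: T * T] (fun x => (h x.2 `^ p * k x `^ r)%:E).
  apply/measurable_EFinP; apply: measurable_funM => //.
  by apply: (measurableT_comp (mhr p)).
have hk0 x : (0 <= (h x.2 `^ p * k x `^ r)%:E)%E.
  by rewrite lee_fin mulr_ge0 ?powR_ge0.
have mH : measurable_fun [set: T] H.
  exact: (measurable_fun_fubini_tonelli_F _ mhk hk0).
pose C := A `^ ((p - 1) * lambda) * M `^ (lambda - 1).
have C0 : 0 <= C by rewrite mulr_ge0 ?powR_ge0.
have key z : ((\int[mu]_w (k (z, w) * h w)%:E) `^ (lambda * p) <= C%:E * H z)%E.
  have st1 : ((\int[mu]_w (k (z, w) * h w)%:E) `^ p <=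
      (A `^ (p - 1))%:E * \int[mu]_w (h w `^ p * k (z, w) `^ (r / lambda))%:E)%E.
    have := @power_mean_integral _ T R mu p A (fun w => k (z, w) `^ r)
      (fun w => k (z, w) `^ (1 - r) * h w) p1 A0 (mkr1 r z) _ _ _ (kA1 z).
    have e1 : (\int[mu]_x (k (z, x) `^ r * (k (z, x) `^ (1 - r) * h x))%:E =
               \int[mu]_w (k (z, w) * h w)%:E)%E.
      apply: eq_integral => w _; rewrite mulrA -powRD.
        by rewrite addrC subrK powRr1.
      by rewrite addrC subrK oner_eq0.
    have e2 : (\int[mu]_x (k (z, x) `^ r * (k (z, x) `^ (1 - r) * h x) `^ p)%:E =
         \int[mu]_w (h w `^ p * k (z, w) `^ (r / lambda))%:E)%E.
      apply: eq_integral => w _.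
      rewrite powRM ?powR_ge0// mulrA -powRrM (mulrC (1 - r)).
      rewrite -powRD; last by rewrite rl gt_eqF ?divr_gt0.
      by rewrite rl mulrC.
    rewrite e1 e2; apply.
    - exact: measurable_funM.
    - by move=> w; rewrite powR_ge0.
    - by move=> w; rewrite mulr_ge0 ?powR_ge0.
  have st2 := @power_mean_integral _ T R mu lambda M (fun w => h w `^ p)
      (fun w => k (z, w) `^ (r / lambda)) l1 M0 (mhr p) (mkr1 _ z) _ _ hM.
  rewrite mulrC poweRrM.
  apply: (@le_trans _ _ (((A `^ (p - 1))%:E *
      \int[mu]_w (h w `^ p * k (z, w) `^ (r / lambda))%:E) `^ lambda)%E).
    apply: gt0_ler_poweR => //; first exact: ltW.
      by rewrite in_itv/= leey poweR_ge0.
    rewrite in_itv/= leey andbT mule_ge0 ?lee_fin ?powR_ge0//.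
    by apply: int0 => w; rewrite mulr_ge0 ?powR_ge0.
  rewrite poweRM ?lee_fin ?powR_ge0//; last first.
    by apply: int0 => w; rewrite mulr_ge0 ?powR_ge0.
  rewrite poweR_EFin -powRrM /C EFinM -muleA.
  apply: lee_wpmul2l; first by rewrite lee_fin powR_ge0.
  apply: (le_trans (st2 _ _)) => [w|w|]; rewrite ?powR_ge0//.
  apply: lee_wpmul2l; first by rewrite lee_fin powR_ge0.
  rewrite /H [leRHS](eq_integral (fun w => (h w `^ p * (k (z, w) `^ (r / lambda)) `^ lambda)%:E))//.
  by move=> w _; rewrite -powRrM divfK ?gt_eqF.
apply: (@le_trans _ _ (\int[mu]_z (C%:E * H z))%E).
  apply: ge0_le_integral => //.
  - by move=> z _; exact: poweR_ge0.
  - apply: (measurableT_comp (measurable_poweR _)).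
    have mkh : measurable_fun [set: T * T] (fun x => (k x * h x.2)%:E).
      apply/measurable_EFinP; apply: measurable_funM => //.
      exact: (measurableT_comp mh).
    apply: (measurable_fun_fubini_tonelli_F _ mkh) => x.
    by rewrite lee_fin mulr_ge0.
  - exact: measurable_funeM.
rewrite ge0_integralZl//; last first.
  by move=> z _; apply: int0 => w; rewrite mulr_ge0 ?powR_ge0.
rewrite /H (fubini_tonelli _ mhk)//=.
apply: (@le_trans _ _ (C%:E * \int[mu]_w (A%:E * (h w `^ p)%:E))%E).
  apply: lee_wpmul2l; first by rewrite lee_fin.
  apply: ge0_le_integral => //.
  - by move=> w _; apply: int0 => z; rewrite mulr_ge0 ?powR_ge0.
  - exact: (measurable_fun_fubini_tonelli_G _ mhk).
  - by apply: measurable_funeM; apply/measurable_EFinP.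
  - move=> w _; under eq_integral do rewrite EFinM.
    rewrite ge0_integralZl//; last 3 first.
    + apply/measurable_EFinP; apply: (measurableT_comp (measurable_powR _)).
      exact: measurableT_comp.
    + by move=> z _; rewrite lee_fin powR_ge0.
    + by rewrite lee_fin powR_ge0.
    by rewrite muleC; apply: lee_wpmul2r; rewrite ?lee_fin ?powR_ge0.
rewrite ge0_integralZl//; last 2 first.
  - exact/measurable_EFinP.
  - by move=> w _; rewrite lee_fin powR_ge0.
rewrite muleA -EFinM; apply: lee_wpmul2r; first by apply: int0 => w; exact: powR_ge0.
rewrite lee_fin /C (@powRD _ A).
  by rewrite powRr1// mulrAC.
apply/implyP => /eqP; have : 0 <= (p - 1) * lambda by rewrite mulr_ge0 ?subr_ge0// ltW.
lra.
Qed.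

(** * Integrals of powers and of Gaussian functions *)

Lemma ocitv_lebesgue_translate (R : realType) (c : R) (X : set R) :
  ocitv X -> lebesgue_measure X = lebesgue_measure ((fun t => t - c) @^-1` X).
Proof.
move=> [[a b] /= _ <-].
rewrite (_ : _ @^-1` _ = `]a + c, b + c]%classic); last first.
  by apply/seteqP; split => x /=; rewrite !in_itv/= ltrBrDr lerBlDr.
rewrite !lebesgue_measure_itv/= !lte_fin ltrD2r -!EFinD.
by rewrite opprD addrACA subrr addr0.
Qed.

Lemma ocitv_lebesgue_reflect (R : realType) (c : R) (X : set R) :
  ocitv X -> lebesgue_measure X = lebesgue_measure ((fun t => c - t) @^-1` X).
Proof.
move=> [[a b] /= _ <-].
rewrite (_ : _ @^-1` _ = `[c - b, c - a[%classic); last first.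
  by apply/seteqP; split => x /=; rewrite !in_itv/=; lra.
rewrite !lebesgue_measure_itv/= !lte_fin ltrD2l ltrN2 -!EFinD.
by case: ifP => // _; congr EFin; ring.
Qed.

(** A measure on the line is determined by its values on the half-open intervals,
    so a map that preserves their lengths leaves the Lebesgue integral invariant. *)
Lemma ge0_integral_lebesgue_preserving (R : realType) (phi : R -> R) (f : R -> \bar R) :
  measurable_fun [set: R] phi ->
  (forall X : set R, ocitv X -> lebesgue_measure X = lebesgue_measure (phi @^-1` X)) ->
  measurable_fun [set: R] f -> (forall t, 0 <= f t)%E ->
  (\int[@lebesgue_measure R]_t f (phi t) = \int[@lebesgue_measure R]_t f t)%E.
Proof.
move=> mphi phiE mf f0.
pose phi' : measurableTypeR R -> measurableTypeR R := phi.
pose m : {measure set (measurableTypeR R) -> \bar R} := pushforward (@lebesgue_measure R) phi'.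
rewrite [RHS](eq_measure_integral (m mphi)).
  by rewrite [RHS]ge0_integral_pushforward.
move=> A mA _; apply: lebesgue_measure_unique => // X /phiE.
Qed.

Lemma integral_powR_itv (R : realType) (beta a b : R) : 0 < beta -> 0 < a < b ->
  (\int[@lebesgue_measure R]_(s in `[a, b]) (s `^ (beta - 1))%:E =
   (b `^ beta / beta - a `^ beta / beta)%:E)%E.
Proof.
move=> b0 /andP[a0 ab].
pose F : R -> R := fun s => beta^-1 * s `^ beta.
have dF (s : R) : 0 < s -> is_derive s 1 F (s `^ (beta - 1)).
  move=> s0; have := is_deriveZ beta^-1 (is_derive1_powR beta s0).
  by rewrite /GRing.scale/= mulKf ?gt_eqF.
have dv (s : R) : 0 < s -> derivable F s 1 by move=> /dF[].
have dc (g : R -> R) (s : R) : derivable g s 1 -> {for s, continuous g}.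
  by move=> ds; apply/differentiable_continuous; rewrite -derivable1_diffP.
rewrite (@continuous_FTC2 _ (fun s => s `^ (beta - 1)) F)//.
- by rewrite /F -EFinB ![beta^-1 * _]mulrC.
- apply: derivable_within_continuous => s; rewrite in_itv/= => /andP[as_ _].
  by apply: derivable_powR; rewrite in_itv/= andbT (lt_le_trans a0).
- split.
  + move=> s; rewrite in_itv/= => /andP[as_ _].
    exact: dv (lt_trans a0 as_).
  + by apply: cvg_at_right_filter; apply: dc; exact: dv.
  + apply: cvg_at_left_filter; apply: dc; exact: dv (lt_trans a0 ab).
- move=> s; rewrite in_itv/= => /andP[as_ _].
  by rewrite derive1E; case: (dF s (lt_trans a0 as_)).
Qed.

(** As s^(beta-1) may blow up at 0, the fundamental theorem of calculus is applied
    on the intervals `[eps / (i + 2), eps], which exhaust `]0, eps]. *)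
Lemma integral_powR_near0 (R : realType) (beta eps : R) : 0 < beta -> 0 < eps ->
  (\int[@lebesgue_measure R]_(s in `]0%R, eps]) (s `^ (beta - 1))%:E <=
   (eps `^ beta / beta)%:E)%E.
Proof.
move=> b0 e0.
(* not i.+1: the left end of each interval must differ from eps *)
pose a (i : nat) := eps / i.+2%:R.
have a0 i : 0 < a i by rewrite divr_gt0.
have ae i : a i < eps by rewrite ltr_pdivrMr// ltr_pMr// ltr1n.
pose F (i : nat) : set (measurableTypeR R) := `[a i, eps]%classic.
have ndF : nondecreasing_seq F.
  move=> i j ij; apply/subsetPset => s; rewrite /F/= !in_itv/= => /andP[ais ->].
  rewrite andbT (le_trans _ ais)// ler_pM2l// lef_pV2 ?posrE//.
  by rewrite ler_nat.
have mf (A : set R) : measurable_fun A (fun s : R => (s `^ (beta - 1))%:E).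
  by apply/measurable_EFinP; apply: measurable_funTS; exact: measurable_powR.
have UF : \bigcup_i F i = `]0, eps]%classic.
  apply/seteqP; split => [s [i _]|s]; rewrite /F/= !in_itv/= => /andP[h1 h2].
    by rewrite h2 (lt_le_trans _ h1).
  have [i ei] : exists i : nat, eps / s <= i%:R.
    by exists (Num.trunc (eps / s)).+1; rewrite ltW// truncnS_gt.
  exists i => //=; rewrite in_itv/= h2 andbT ler_pdivrMr//.
  rewrite ler_pdivrMr// in ei; rewrite mulrC (le_trans ei)// ler_pM2r//.
  by rewrite ler_nat ltnW// ltnW.
have cv := @ge0_nondecreasing_set_cvg_integral _ _ R F
  (fun s => (s `^ (beta - 1))%:E) (@lebesgue_measure R) ndF _ _ _.
rewrite UF in cv.
apply: (cvge_le _ (cv _ _ _)) => //.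
- apply: nearW => i; rewrite integral_powR_itv ?a0 ?ae//.
  by rewrite lee_fin lerBlDr lerDl divr_ge0 ?powR_ge0// ltW.
- by move=> i; exact: measurable_itv.
- by move=> i; exact: mf.
- by move=> i s _; rewrite lee_fin powR_ge0.
Qed.

Lemma integral_gauss_centered (R : realType) (c y : R) : 0 < c ->
  (\int[@lebesgue_measure R]_x (expR (- (c * (x - y) ^+ 2)))%:E =
   (Num.sqrt (pi / c))%:E)%E.
Proof.
move=> c0.
(* the function is, up to a factor, the normal density with this deviation *)
pose s : R := Num.sqrt (2 * c)^-1.
have c20 : 0 < (2 * c)^-1 by rewrite invr_gt0 mulr_gt0.
have s0 : s != 0 by rewrite gt_eqF// sqrtr_gt0.
have s2 : s ^+ 2 = (2 * c)^-1 by rewrite sqr_sqrtr// ltW.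
have := integral_normal_pdf y s.
rewrite normal_pdfE//.
have e (x : R) : normal_fun y s x = expR (- (c * (x - y) ^+ 2)).
  rewrite /normal_fun s2; congr expR.
  by field; rewrite gt_eqF.
under eq_integral do rewrite e EFinM.
have p0 := normal_peak_gt0 s0.
rewrite ge0_integralZl//.
- have -> : normal_peak s = (Num.sqrt (pi / c))^-1.
    by rewrite /normal_peak s2; congr (Num.sqrt _)^-1; field; rewrite gt_eqF.
  move=> H.
  have q0 : Num.sqrt (pi / c) != 0 by rewrite gt_eqF// sqrtr_gt0 divr_gt0// pi_gt0.
  have := congr1 (mule (Num.sqrt (pi / c))%:E) H.
  by rewrite muleA -EFinM divff// mul1e mule1.
- apply/measurable_EFinP; apply: (eq_measurable_fun (normal_fun y s)) => //.
  exact: measurable_normal_fun.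
- by rewrite lee_fin ltW.
Qed.

Lemma measurable_sqnorm_sub (R : realType) (n : nat) (y : n.-tuple R) :
  measurable_fun [set: n.-tuple (measurableTypeR R)]
    (fun x => sqnorm (tuple_sub x y)).
Proof.
apply: measurable_sum => i.
apply: (eq_measurable_fun (fun x : n.-tuple (measurableTypeR R) => (tnth x i - tnth y i) ^+ 2)).
  by move=> x _; rewrite tnth_mktuple.
apply: measurable_funX; apply: measurable_funB => //; exact: measurable_tnth.
Qed.

Lemma sqnorm_sub_cons (R : realType) (n : nat) (a : R) (x : n.-tuple R) (y : n.+1.-tuple R) :
  sqnorm (tuple_sub (tuple_cons (a, x)) y) =
  (a - thead y) ^+ 2 + sqnorm (tuple_sub x [tuple of behead y]).
Proof.
rewrite /sqnorm big_ord_recl; congr (_ + _).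
  by rewrite tnth_mktuple.
apply: eq_bigr => i _; rewrite !tnth_mktuple.
by rewrite !(tnth_nth 0) /= nth_behead.
Qed.

Lemma sqnorm_subC (R : realType) (n : nat) (x y : n.-tuple R) :
  sqnorm (tuple_sub x y) = sqnorm (tuple_sub y x).
Proof. by apply: eq_bigr => i _; rewrite !tnth_mktuple -sqrrN opprB. Qed.

Lemma measurable_gauss_tuple (R : realType) (n : nat) (c : R) (y : n.-tuple R) :
  measurable_fun [set: n.-tuple (measurableTypeR R)]
    (fun x => (expR (- (c * sqnorm (tuple_sub x y))))%:E).
Proof.
apply/measurable_EFinP; apply: measurableT_comp => //.
apply: measurableT_comp => //; apply: measurable_funM => //.
exact: measurable_sqnorm_sub.
Qed.

Lemma integral_gauss_tuple (R : realType) (n : nat) (c : R) (y : n.-tuple R) :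
  0 < c ->
  (\int[lebesgue_tuple R n]_x (expR (- (c * sqnorm (tuple_sub x y))))%:E =
   (Num.sqrt (pi / c) ^+ n)%:E)%E.
Proof.
move=> c0; elim: n y => [|n IH] y /=.
  rewrite integral_dirac//; last exact: measurable_gauss_tuple.
  by rewrite diracE in_setT mul1e /sqnorm big_ord0 mulr0 oppr0 expR0 expr0.
rewrite /lebesgue_tuple_cons ge0_integral_pushforward//; last 2 first.
  - exact: measurable_tuple_cons.
  - exact: measurable_gauss_tuple.
rewrite preimage_setT fubini_tonelli1; last 2 first.
- exact: (measurableT_comp (measurable_gauss_tuple _ _ _ _) (@measurable_tuple_cons R n)).
- by move=> x; rewrite lee_fin expR_ge0.
rewrite /fubini_F.
transitivity (\int[@lebesgue_measure R]_a
  ((Num.sqrt (pi / c) ^+ n)%:E * (expR (- (c * (a - thead y) ^+ 2)))%:E))%E.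
  apply: eq_integral => a _.
  rewrite -(IH [tuple of behead y]) muleC -ge0_integralZl//.
  - by apply: eq_integral => x _; rewrite /= sqnorm_sub_cons mulrDr opprD expRD EFinM.
  - exact: measurable_gauss_tuple.
rewrite ge0_integralZl//.
- by rewrite integral_gauss_centered// -EFinM exprSr.
- apply/measurable_EFinP; apply: measurableT_comp => //.
  apply: measurableT_comp => //; apply: measurable_funM => //.
  by apply: measurable_funX; apply: measurable_funB.
Qed.

(** * The heat kernel with bounded time lag *)

Lemma Gamma_ge0 (R : realType) (a : R) : 0 <= Gamma a.
Proof.
rewrite fine_ge0// integral_ge0// => s _.
by rewrite lee_fin mulr_ge0 ?powR_ge0 ?expR_ge0.
Qed.

Lemma Phi_ge0 (R : realType) (n : nat) (alpha : R) (x : n.-tuple R) (t : R) :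
  0 <= Phi alpha x t.
Proof.
rewrite /Phi !mulr_ge0 ?expR_ge0 ?powR_ge0 ?invr_ge0 ?Gamma_ge0 ?powR_ge0//.
Qed.

Lemma PhiE (R : realType) (n : nat) (alpha : R) (x : n.-tuple R) (s : R) :
  0 < s ->
  Phi alpha x s = (Gamma alpha)^-1 * (4 * pi) `^ (- (n%:R / 2))
    * s `^ (alpha - 1 - n%:R / 2) * expR (- (sqnorm x * (4 * s)^-1)).
Proof.
move=> s0; rewrite /Phi indicE mem_set/= ?in_itv/= ?s0// mulr1.
congr (_ * _); rewrite powRM ?(ltW s0)//; last by rewrite mulr_ge0// pi_ge0.
rewrite (@powRB _ s (alpha - 1)); last by rewrite (gt_eqF s0) implybT.
by rewrite invfM powRN; ring.
Qed.

(** The r-th power of the kernel is again a Gaussian in space times a power of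
    time, so that its integral is explicit. *)
Lemma Phi_powR (R : realType) (n : nat) (alpha r : R) (x : n.-tuple R) (s : R) :
  0 < s ->
  Phi alpha x s `^ r = ((Gamma alpha)^-1 * (4 * pi) `^ (- (n%:R / 2))) `^ r
    * s `^ ((alpha - 1 - n%:R / 2) * r) * expR (- (r / (4 * s) * sqnorm x)).
Proof.
move=> s0; rewrite PhiE//.
have G0 : 0 <= (Gamma alpha)^-1 by rewrite invr_ge0 Gamma_ge0.
rewrite (@powRM _ _ _ r) ?expR_ge0 ?mulr_ge0 ?powR_ge0//.
rewrite (@powRM _ _ _ r) ?mulr_ge0 ?powR_ge0//.
rewrite -(powRrM s); congr (_ * _).
rewrite {1}/powR gt_eqF ?expR_gt0// expRK; congr expR; ring.
Qed.

Section kernel.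
Variables (R : realType) (n : nat).
Local Notation S := (spacetime R n).
Implicit Types alpha eps : R.

(** On a time slab of height eps before which f vanishes, J f only sees this part
    of its kernel. *)
Definition slab_kernel alpha eps (zw : S * S) : R :=
  Phi alpha (tuple_sub zw.1.1 zw.2.1) (zw.1.2 - zw.2.2)
    * \1_(`]0, eps]) (zw.1.2 - zw.2.2 : R).

Lemma slab_kernel_ge0 alpha eps zw : 0 <= slab_kernel alpha eps zw.
Proof. by rewrite mulr_ge0 ?Phi_ge0. Qed.

(** Division is replaced by the power with exponent -1, which is measurable on the
    whole line; the two agree where the indicator function does not vanish. *)
Lemma measurable_kernel alpha : measurable_fun [set: S * S]
  (fun zw => Phi alpha (tuple_sub zw.1.1 zw.2.1) (zw.1.2 - zw.2.2)).
Proof.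
pose sq (zw : S * S) : R := sqnorm (tuple_sub zw.1.1 zw.2.1).
pose tm (zw : S * S) : R := zw.1.2 - zw.2.2.
have mt : measurable_fun [set: S * S] tm.
  apply: measurable_funB.
    exact: (measurableT_comp measurable_snd measurable_fst).
  exact: (measurableT_comp measurable_snd measurable_snd).
have mtn (f : S * S -> S) i : measurable_fun setT f ->
    measurable_fun [set: S * S] (fun zw => tnth (f zw).1 i).
  move=> mf; apply: (measurableT_comp (measurable_tnth i)).
  exact: (measurableT_comp measurable_fst mf).
have ms : measurable_fun [set: S * S] sq.
  apply: measurable_sum => i.
  apply: (eq_measurable_fun (fun zw : S * S => (tnth zw.1.1 i - tnth zw.2.1 i) ^+ 2)).
    by move=> zw _; rewrite tnth_mktuple.
  by apply: measurable_funX; apply: measurable_funB; apply: mtn.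
apply: (eq_measurable_fun (fun zw => (Gamma alpha)^-1 * (4 * pi) `^ (- (n%:R / 2))
    * tm zw `^ (alpha - 1 - n%:R / 2)
    * expR (- (sq zw * (4 * tm zw) `^ (- 1))) * \1_(`]0, +oo[) (tm zw))).
  move=> zw _; have [t0|t0] := ltP 0 (tm zw).
    rewrite PhiE// powR_inv1 ?indicE ?mem_set ?mulr1//= ?in_itv/= ?t0//.
    by rewrite mulr_ge0// ltW.
  by rewrite /Phi !indicE !memNset ?mulr0//= in_itv/= andbT; apply/negP; rewrite -leNgt.
apply: measurable_funM; last first.
  by apply: (measurableT_comp _ mt); apply: measurable_indic.
apply: measurable_funM.
  apply: measurable_funM => //.
  by apply: (measurableT_comp (measurable_powR _)).
do 2 apply: measurableT_comp => //.
apply: measurable_funM => //; apply: (measurableT_comp (measurable_powR _)).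
exact: measurable_funM.
Qed.

Lemma measurable_slab_kernel alpha eps :
  measurable_fun [set: S * S] (slab_kernel alpha eps).
Proof.
apply: measurable_funM; first exact: measurable_kernel.
have mt : measurable_fun [set: S * S] (fun zw : S * S => zw.1.2 - zw.2.2 : R).
  apply: measurable_funB.
    exact: (measurableT_comp measurable_snd measurable_fst).
  exact: (measurableT_comp measurable_snd measurable_snd).
by apply: (measurableT_comp _ mt); apply: measurable_indic.
Qed.

End kernel.
Arguments slab_kernel {R n} alpha eps zw.
Arguments measurable_slab_kernel {R n} alpha eps.

Section kernel_integral.
Variables (R : realType) (n : nat) (alpha r : R).
Local Notation S := (spacetime R n).
Local Notation mu := (spacetime_measure R n).
Hypothesis r0 : 0 < r.
(* the integral of the r-th power over space is a multiple of t^(beta - 1) *)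
Local Notation beta := ((alpha - 1 - n%:R / 2) * r + n%:R / 2 + 1).

Definition kernel_cst : R :=
  ((Gamma alpha)^-1 * (4 * pi) `^ (- (n%:R / 2))) `^ r * Num.sqrt (4 * pi / r) ^+ n.

Lemma kernel_cst_ge0 : 0 <= kernel_cst.
Proof. by rewrite mulr_ge0 ?powR_ge0 ?exprn_ge0. Qed.

(** The Gaussian integral contributes the power t^(n/2). *)
Lemma integral_slab_kernel_space (eps s : R) (y : n.-tuple R) :
  (\int[lebesgue_tuple R n]_x
      ((Phi alpha (tuple_sub x y) s * \1_(`]0%R, eps]) s) `^ r)%:E =
   (kernel_cst * (s `^ (beta - 1) * \1_(`]0%R, eps]) s))%:E)%E.
Proof.
have [|] := boolP (s \in `]0, eps]); rewrite in_itv/=; last first.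
  move=> s0; have -> : \1_(`]0, eps]) s = 0 :> R.
    by rewrite indicE memNset//= in_itv/=; exact/negP.
  rewrite !mulr0; apply: integral0_eq => x _.
  by rewrite mulr0 powR0 ?gt_eqF.
move=> /[dup] se /andP[s0 _].
have -> : \1_(`]0, eps]) s = 1 :> R by rewrite indicE mem_set//= in_itv/=.
rewrite mulr1; under eq_integral do rewrite mulr1 Phi_powR// EFinM.
have c0 : 0 < r / (4 * s) by rewrite divr_gt0// mulr_gt0.
rewrite ge0_integralZl//; last 2 first.
- exact: measurable_gauss_tuple.
- by rewrite lee_fin mulr_ge0 ?powR_ge0.
rewrite integral_gauss_tuple// -EFinM; congr EFin.
have -> : pi / (r / (4 * s)) = 4 * pi / r * s.
  by field; rewrite !gt_eqF.
rewrite sqrtrM; last by rewrite divr_ge0 ?mulr_ge0 ?pi_ge0 ?ltW.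
rewrite exprMn /kernel_cst.
have -> : Num.sqrt s ^+ n = s `^ (n%:R / 2).
  by rewrite -powR12_sqrt ?ltW// -powR_mulrn ?powR_ge0// -powRrM mulrC.
have -> : beta - 1 = (alpha - 1 - n%:R / 2) * r + n%:R / 2 by ring.
rewrite powRD; last by rewrite (gt_eqF s0) implybT.
by ring.
Qed.

Lemma measurable_time_weight eps : measurable_fun [set: R]
  (fun s : R => (kernel_cst * (s `^ (beta - 1) * \1_(`]0%R, eps]) s))%:E).
Proof.
apply/measurable_EFinP; do 2 apply: measurable_funM => //.
Qed.

Lemma integral_slab_kernel_time (eps : R) : 0 < beta -> 0 < eps ->
  (\int[@lebesgue_measure R]_s
     (kernel_cst * (s `^ (beta - 1) * \1_(`]0%R, eps]) s))%:E
   <= (kernel_cst / beta * eps `^ beta)%:E)%E.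
Proof.
move=> b0 e0; under eq_integral do rewrite EFinM.
rewrite ge0_integralZl//; last 3 first.
- apply/measurable_EFinP; apply: measurable_funM => //.
- by move=> s _; rewrite lee_fin mulr_ge0 ?powR_ge0.
- by rewrite lee_fin kernel_cst_ge0.
have -> : (\int[@lebesgue_measure R]_s (s `^ (beta - 1) * \1_(`]0%R, eps]) s)%:E =
    \int[@lebesgue_measure R]_(s in `]0%R, eps]) (s `^ (beta - 1))%:E)%E.
  by rewrite [RHS]integral_mkcond epatch_indic; apply: eq_integral => s _; rewrite EFinM.
have -> : kernel_cst / beta * eps `^ beta = kernel_cst * (eps `^ beta / beta).
  by rewrite mulrAC mulrA.
rewrite [leRHS]EFinM; apply: lee_wpmul2l.
  by rewrite lee_fin kernel_cst_ge0.
exact: integral_powR_near0.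
Qed.

(** This bound and the next one make the kernel satisfy the assumptions of
    Young's inequality; positivity of beta is what makes the bound small with
    eps. *)
Lemma integral_slab_kernel_left (eps : R) (w : S) : 0 < beta -> 0 < eps ->
  (\int[mu]_z (slab_kernel alpha eps (z, w) `^ r)%:E <=
   (kernel_cst / beta * eps `^ beta)%:E)%E.
Proof.
move=> b0 e0; rewrite /spacetime_measure fubini_tonelli2; last 2 first.
- apply/measurable_EFinP; apply: (measurableT_comp (measurable_powR _)).
  apply: (measurableT_comp (measurable_slab_kernel _ _)) => //.
- by move=> z; rewrite lee_fin powR_ge0.
rewrite /fubini_G/=.
have e (t : R) : (\int[lebesgue_tuple R n]_x (slab_kernel alpha eps ((x, t), w) `^ r)%:E =
    (kernel_cst * ((t - w.2) `^ (beta - 1) * \1_(`]0%R, eps]) (t - w.2)))%:E)%E.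
  by rewrite -(integral_slab_kernel_space _ _ w.1).
under eq_integral do rewrite e.
apply: le_trans (integral_slab_kernel_time _ b0 e0).
rewrite -[leRHS](@ge0_integral_lebesgue_preserving _ (fun t => t - w.2))//.
- exact: measurable_funB.
- exact: ocitv_lebesgue_translate.
- exact: measurable_time_weight.
- by move=> s; rewrite lee_fin !mulr_ge0 ?kernel_cst_ge0 ?powR_ge0.
Qed.

Lemma integral_slab_kernel_right (eps : R) (z : S) : 0 < beta -> 0 < eps ->
  (\int[mu]_w (slab_kernel alpha eps (z, w) `^ r)%:E <=
   (kernel_cst / beta * eps `^ beta)%:E)%E.
Proof.
move=> b0 e0; rewrite /spacetime_measure fubini_tonelli2; last 2 first.
- apply/measurable_EFinP; apply: (measurableT_comp (measurable_powR _)).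
  apply: (measurableT_comp (measurable_slab_kernel _ _)) => //.
- by move=> w; rewrite lee_fin powR_ge0.
rewrite /fubini_G/=.
have e (t : R) : (\int[lebesgue_tuple R n]_x (slab_kernel alpha eps (z, (x, t)) `^ r)%:E =
    (kernel_cst * ((z.2 - t) `^ (beta - 1) * \1_(`]0%R, eps]) (z.2 - t)))%:E)%E.
  rewrite -(integral_slab_kernel_space _ _ z.1); apply: eq_integral => x _.
  by rewrite /slab_kernel/= /Phi sqnorm_subC.
under eq_integral do rewrite e.
apply: le_trans (integral_slab_kernel_time _ b0 e0).
rewrite -[leRHS](@ge0_integral_lebesgue_preserving _ (fun t => z.2 - t))//.
- exact: measurable_funB.
- exact: ocitv_lebesgue_reflect.
- exact: measurable_time_weight.
- by move=> s; rewrite lee_fin !mulr_ge0 ?kernel_cst_ge0 ?powR_ge0.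
Qed.

End kernel_integral.

(** * Vanishing, one time slab after the other *)

Section vanishing.
Variables (R : realType) (n : nat).
Local Notation S := (spacetime R n).
Local Notation mu := (spacetime_measure R n).

(* type class search does not see through the product measurable structure *)
#[local] Instance ae_spacetime_filter : Filter (almost_everywhere mu).
Proof. exact: (@ae_filter_ringOfSetsType _ S R mu). Qed.

Lemma measurable_past (T : R) : measurable (past T : set S).
Proof.
have -> : past T = [set: S] `&` snd @^-1` `]-oo, T[%classic.
  by apply/seteqP; split => z /=; rewrite /past/= in_itv/=; [|case].
exact: measurable_snd.
Qed.

(** J alpha g before it is truncated to a real number: the value +oo is kept. *)
Definition heat_potential (alpha : R) (g : S -> R) (z : S) : \bar R :=
  (\int[mu]_(w in past z.2) (Phi alpha (tuple_sub z.1 w.1) (z.2 - w.2) * g w)%:E)%E.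

Lemma measurable_heat_integrand (alpha : R) (g : S -> R) (z : S) (D : set S) :
  measurable_fun [set: S] g ->
  measurable_fun D (fun w : S => (Phi alpha (tuple_sub z.1 w.1) (z.2 - w.2) * g w)%:E).
Proof.
move=> mg; apply: measurable_funTS; apply/measurable_EFinP; apply: measurable_funM => //.
exact: (measurable_fun_pair2 z (measurable_kernel R n alpha)).
Qed.

Lemma heat_potential_ge0 (alpha : R) (g : S -> R) (z : S) :
  (forall w, 0 <= g w) -> (0 <= heat_potential alpha g z)%E.
Proof.
by move=> g0; apply: integral_ge0 => w _; rewrite lee_fin mulr_ge0 ?Phi_ge0.
Qed.

(** The contribution of times before T0 is 0, and a point w earlier than z but not
    earlier than T0 has time lag at most T - T0 <= eps. *)
Lemma heat_potential_le_slab (alpha T0 T eps : R) (g : S -> R) (z : S) :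
  measurable_fun [set: S] g -> (forall w, 0 <= g w) ->
  (\forall w \ae mu, (w.2 : R) < T0 -> g w = 0) ->
  T <= T0 + eps -> (z.2 : R) < T ->
  (heat_potential alpha g z <=
    \int[mu]_w (slab_kernel alpha eps (z, w) * (g w * \1_(past T) w))%:E)%E.
Proof.
move=> mg g0 gT0 Teps zT.
rewrite /heat_potential integral_mkcond; apply: ae_ge0_le_integral => //.
- by move=> w _; rewrite patchE; case: ifP => // _; rewrite lee_fin mulr_ge0 ?Phi_ge0.
- apply/(measurable_restrictT _ _).1; first exact: measurable_past.
  exact: measurable_heat_integrand.
- by move=> w _; rewrite lee_fin mulr_ge0 ?slab_kernel_ge0// mulr_ge0.
- apply/measurable_EFinP; apply: measurable_funM.
    by apply: (measurableT_comp (measurable_slab_kernel _ _)).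
  apply: measurable_funM => //; apply: measurable_indic; exact: measurable_past.
- apply: filterS gT0 => w gw _; rewrite patchE.
  have K0 : 0 <= slab_kernel alpha eps (z, w) * (g w * \1_(past T) w).
    by rewrite mulr_ge0 ?slab_kernel_ge0// mulr_ge0.
  case: ifPn => [|_]; last by rewrite lee_fin.
  rewrite inE/= /past/= => wz.
  have [wT0|wT0] := ltP (w.2 : R) T0; first by move: K0; rewrite lee_fin gw// mul0r !mulr0.
  rewrite lee_fin /slab_kernel/= !indicE !mem_set/= ?mulr1//.
    by rewrite /past/=; exact: lt_trans zT.
  by rewrite in_itv/=; lra.
Qed.

Lemma ge0_integral_eq0_ae (f : S -> R) : measurable_fun [set: S] f ->
  (forall z, 0 <= f z) -> (\int[mu]_z (f z)%:E = 0)%E ->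
  \forall z \ae mu, f z = 0.
Proof.
move=> mf f0 If.
have mE : measurable_fun [set: S] (EFin \o f) by exact/measurable_EFinP.
have /(ae_eq_integral_abs mu measurableT mE) : (\int[mu]_z `|(EFin \o f) z| = 0)%E.
  by rewrite -If; apply: eq_integral => z _ /=; rewrite ger0_norm.
by apply: filterS => z /(_ I) /= [].
Qed.

(** With N the integral of g^p over times before T, Young's inequality and
    g <= (J g)^lambda give N <= c N, where c = a^((p-1) lambda + 1) M^(lambda-1) < 1;
    as N is finite, it is 0. *)
Lemma vanishing_step (p lambda alpha r a M T0 T eps : R) (g : S -> R) :
  1 <= p -> 1 <= lambda -> 0 < r -> r^-1 = 1 - p^-1 + (lambda * p)^-1 ->
  0 <= a -> a `^ ((p - 1) * lambda + 1) * M `^ (lambda - 1) < 1 ->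
  measurable_fun [set: S] g -> (forall w, 0 <= g w) ->
  (\forall z \ae mu, (g z)%:E <= heat_potential alpha g z `^ lambda)%E ->
  (\forall w \ae mu, (w.2 : R) < T0 -> g w = 0) ->
  T <= T0 + eps ->
  (\int[mu]_w ((g w * \1_(past T) w) `^ p)%:E <= M%:E)%E ->
  (forall z, \int[mu]_w (slab_kernel alpha eps (z, w) `^ r)%:E <= a%:E)%E ->
  (forall w, \int[mu]_z (slab_kernel alpha eps (z, w) `^ r)%:E <= a%:E)%E ->
  \forall w \ae mu, (w.2 : R) < T -> g w = 0.
Proof.
move=> p1 l1 r0 rE a0 aM1 mg g0 gU gT0 Teps hM ka1 ka2.
have p0 : 0 < p by lra.
pose h w : R := g w * \1_(past T) w.
have mh : measurable_fun [set: S] h.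
  by apply: measurable_funM => //; apply: measurable_indic; exact: measurable_past.
have h0 w : 0 <= h w by rewrite mulr_ge0.
have mhp : measurable_fun [set: S] (fun w => h w `^ p).
  by apply: (measurableT_comp (measurable_powR _)).
pose N := (\int[mu]_w (h w `^ p)%:E)%E.
have N0 : (0 <= N)%E by apply: integral_ge0 => w _; rewrite lee_fin powR_ge0.
have M0 : 0 <= M by rewrite -lee_fin (le_trans N0).
have mk := measurable_slab_kernel (n := n) alpha eps.
have k0 := slab_kernel_ge0 R n alpha eps.
have Y := @young_integral_operator _ _ R mu p lambda r a M _ h p1 l1 r0 rE a0 M0
  mk mh k0 h0 ka1 ka2 hM.
have mkh : measurable_fun [set: S * S] (fun x => (slab_kernel alpha eps x * h x.2)%:E).
  by apply/measurable_EFinP; apply: measurable_funM => //; exact: (measurableT_comp mh).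
have NY : (N <= \int[mu]_z
    (\int[mu]_w (slab_kernel alpha eps (z, w) * h w)%:E) `^ (lambda * p))%E.
  apply: ae_ge0_le_integral => //.
  - by move=> w _; rewrite lee_fin powR_ge0.
  - exact/measurable_EFinP.
  - by move=> w _; exact: poweR_ge0.
  - apply: (measurableT_comp (measurable_poweR _)).
    apply: (measurable_fun_fubini_tonelli_F _ mkh) => x.
    by rewrite lee_fin mulr_ge0.
  - apply: filterS gU => z gz _; rewrite /h.
    have [zT|zT] := ltP (z.2 : R) T; last first.
      rewrite indicE memNset ?mulr0 ?powR0 ?gt_eqF ?poweR_ge0//.
      by rewrite /past/=; apply/negP; rewrite -leNgt.
    rewrite indicE mem_set// mulr1 -poweR_EFin poweRrM.
    have I0 : (0 <= \int[mu]_w (slab_kernel alpha eps (z, w) * h w)%:E)%E.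
      by apply: integral_ge0 => w _; rewrite lee_fin mulr_ge0.
    apply: gt0_ler_poweR; rewrite ?in_itv/= ?leey ?lee_fin ?g0 ?poweR_ge0//; first exact: ltW.
    apply: (le_trans gz); apply: gt0_ler_poweR; rewrite ?in_itv/= ?leey ?heat_potential_ge0 ?I0//.
      lra.
    exact: (heat_potential_le_slab alpha T0).
have {NY Y} NN := le_trans NY Y.
have Nfin : N \is a fin_num by rewrite ge0_fin_numE// (le_lt_trans hM)// ltry.
have N_eq0 : N = 0%E.
  rewrite -/N -(fineK Nfin) -EFinM lee_fin in NN.
  rewrite -(fineK Nfin); congr EFin.
  have : 0 <= fine N by exact: fine_ge0.
  rewrite le_eqVlt => /predU1P[<-//|Np].
  by move: NN; rewrite leNgt gtr_pMl// aM1.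
have := ge0_integral_eq0_ae _ mhp (fun w => powR_ge0 _ _) N_eq0.
apply: filterS => w /powR_eq0_eq0; rewrite /h indicE => + wT.
by rewrite mem_set// mulr1.
Qed.

(** The slabs are cut off at T, as the height eps that a step can reach is
    controlled by the integral of g^p over times before T. *)
Lemma vanishing_slabs (eps T : R) (g : S -> R) : 0 < eps ->
  (forall T0 T1, T1 <= T -> T1 <= T0 + eps ->
    (\forall w \ae mu, (w.2 : R) < T0 -> g w = 0) ->
    (\forall w \ae mu, (w.2 : R) < T1 -> g w = 0)) ->
  (\forall w \ae mu, (w.2 : R) < 0 -> g w = 0) ->
  (\forall w \ae mu, (w.2 : R) < T -> g w = 0).
Proof.
move=> e0 step g0.
have slab (k : nat) : \forall w \ae mu, (w.2 : R) < Num.min (eps *+ k) T -> g w = 0.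
  elim: k => [|k IH].
    apply: filterS g0 => w gw wT; apply: gw; move: wT.
    by rewrite mulr0n lt_min => /andP[].
  apply: step IH; first by rewrite ge_min lexx orbT.
  rewrite addr_minl le_min !ge_min mulrSr lexx/=.
  by rewrite lerDl (ltW e0) orbT.
have [k Tk] : exists k : nat, T <= eps *+ k.
  exists (Num.trunc (T / eps)).+1.
  by rewrite -mulr_natr mulrC -ler_pdivrMr// ltW// truncnS_gt.
by have := slab k; rewrite min_r.
Qed.

End vanishing.

Lemma exists_powR_mul_lt1 (R : realType) (q M : R) : 1 <= q -> 0 <= M ->
  exists2 a : R, 0 < a & a `^ q * M < 1.
Proof.
move=> q1 M0; exists (M + 1)^-1; first by rewrite invr_gt0; lra.
have M1 : 0 < M + 1 by lra.
apply: (@le_lt_trans _ _ ((M + 1)^-1 * M)).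
  by rewrite ler_wpM2r// ge1r_powR// invr_gt0 M1/= invf_le1//; lra.
by rewrite mulrC ltr_pdivrMr//; lra.
Qed.

Lemma exists_mul_powR_le (R : realType) (D beta a : R) : 0 <= D -> 0 < beta -> 0 < a ->
  exists2 eps : R, 0 < eps & D * eps `^ beta <= a.
Proof.
move=> D0 b0 a0; exists ((a / (D + 1)) `^ beta^-1).
  by apply: powR_gt0; rewrite divr_gt0//; lra.
rewrite -powRrM mulVf ?gt_eqF// powRr1; last by rewrite divr_ge0 ?(ltW a0)//; lra.
rewrite mulrCA ler_piMr ?(ltW a0)// ler_pdivrMr; lra.
Qed.
Arguments heat_potential {R n} alpha g z.

Section uniqueness.
Variables (R : realType) (n : nat).
Local Notation S := (spacetime R n).
Local Notation mu := (spacetime_measure R n).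
#[local] Existing Instance ae_spacetime_filter.

(** The height of the slabs is chosen once T is fixed: a makes the factor of the
    vanishing step less than 1, and eps makes the integrals of the kernel at most a.
    The assumption on alpha enters as positivity of the exponent beta of eps. *)
Lemma heat_potential_power_uniqueness (p alpha lambda : R) (g : S -> R) :
  1 <= p -> 1 <= lambda ->
  (n%:R + 2) / (2 * p) * (1 - 1 / lambda) < alpha ->
  measurable_fun [set: S] g -> (forall w, 0 <= g w) ->
  (forall T, \int[mu]_w ((g w * \1_(past T) w) `^ p)%:E < +oo)%E ->
  (\forall z \ae mu, (g z)%:E <= heat_potential alpha g z `^ lambda)%E ->
  (\forall w \ae mu, (w.2 : R) < 0 -> g w = 0) ->
  \forall w \ae mu, g w = 0.
Proof.
move=> p1 l1 al mg g0 gfin gU gneg.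
have p0 : 0 < p by lra.
have l0 : 0 < lambda by lra.
have lp0 : 0 < lambda * p by rewrite mulr_gt0.
pose rV := 1 - p^-1 + (lambda * p)^-1.
have rV0 : 0 < rV.
  by rewrite ltr_wpDl// ?invr_gt0// subr_ge0 invf_le1.
pose r := rV^-1.
have r0 : 0 < r by rewrite invr_gt0.
have rE : r^-1 = rV by rewrite invrK.
have b0 : 0 < (alpha - 1 - n%:R / 2) * r + n%:R / 2 + 1.
  have -> : (alpha - 1 - n%:R / 2) * r + n%:R / 2 + 1 =
      r * (alpha - (n%:R + 2) / (2 * p) * (1 - 1 / lambda)).
    have H : r * rV = 1 by rewrite mulVf ?gt_eqF.
    transitivity ((alpha - 1 - n%:R / 2) * r + (n%:R / 2 + 1) * (r * rV)).
      by rewrite H mulr1 addrA.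
    by rewrite /rV; field; rewrite !gt_eqF.
  by rewrite mulr_gt0// subr_gt0.
suff H N : \forall w \ae mu, (w.2 : R) < N%:R -> g w = 0.
  apply: filterS (ae_foralln H) => w gw.
  by apply: (gw (Num.trunc (w.2 : R)).+1); exact: truncnS_gt.
pose I := (\int[mu]_w ((g w * \1_(past N%:R) w) `^ p)%:E)%E.
have I0 : (0 <= I)%E by apply: integral_ge0 => w _; rewrite lee_fin powR_ge0.
have Ifin : I \is a fin_num by rewrite ge0_fin_numE//; exact: gfin.
pose M := fine I.
have [a a0 aM] := @exists_powR_mul_lt1 R ((p - 1) * lambda + 1) (M `^ (lambda - 1))
  ltac:(by rewrite lerDr mulr_ge0// ?subr_ge0// ltW) (powR_ge0 _ _).
have [eps e0 De] := @exists_mul_powR_le R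
  (kernel_cst R n alpha r / ((alpha - 1 - n%:R / 2) * r + n%:R / 2 + 1)) _ a
  ltac:(by rewrite divr_ge0 ?kernel_cst_ge0// ltW) b0 a0.
apply: (vanishing_slabs _ _ eps) gneg => // T0 T1 T1N T1e.
move=> gT0.
apply: (@vanishing_step R n p lambda alpha r a M T0 T1 eps g) => //.
- exact: ltW.
- rewrite /M fineK//; apply: ge0_le_integral => //.
  + by move=> w _; rewrite lee_fin powR_ge0.
  + apply/measurable_EFinP; apply: (measurableT_comp (measurable_powR _)).
    by apply: measurable_funM => //; apply: measurable_indic; exact: measurable_past.
  + apply/measurable_EFinP; apply: (measurableT_comp (measurable_powR _)).
    by apply: measurable_funM => //; apply: measurable_indic; exact: measurable_past.
  + move=> w _; rewrite lee_fin ge0_ler_powR ?nnegrE ?mulr_ge0 ?(ltW p0)//.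
    apply: ler_wpM2l => //; rewrite !indicE ler_nat.
    have [|] := boolP (w \in past T1); last by [].
    rewrite inE /past/= => wT.
    by rewrite mem_set//=; exact: lt_le_trans T1N.
- move=> z; apply: le_trans (integral_slab_kernel_right _ _ _ _ r0 _ _ b0 e0) _.
  by rewrite lee_fin.
- move=> w; apply: le_trans (integral_slab_kernel_left _ _ _ _ r0 _ _ b0 e0) _.
  by rewrite lee_fin.
Qed.

End uniqueness.

Theorem theorem3p1 (R : realType) (n : nat) (p alpha lambda : R)
    (u : spacetime R n -> R) :
  (1 <= n)%N ->
  [\/ 1 < p /\ 0 < alpha < (n%:R + 2) / (2 * p)
    | p = 1 /\ 0 < alpha <= (n%:R + 2) / (2 * p)] ->
  1 <= lambda ->
  (n%:R + 2) / (2 * p) * (1 - 1 / lambda) < alpha ->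
  Yspace alpha p u ->
  (\forall z \ae spacetime_measure R n,
    0 <= fheat alpha p u z <= u z `^ lambda) ->
  (\forall z \ae spacetime_measure R n, (z.2 : R) < 0 -> u z = 0) ->
  (\forall z \ae spacetime_measure R n, u z = 0 /\ fheat alpha p u z = 0).
Proof.
move=> _ pE l1 al [f0 Xf0 uf0] fu uneg.
have p1 : 1 <= p by case: pE => [[/ltW]|[->]].
have p0 : 0 < p by lra.
have l0 : 0 < lambda by lra.
pose FF := @ae_spacetime_filter R n.
pose f := fheat alpha p u.
have [[mf fp] uf] : Xspace p f /\ u = J alpha f %[ae spacetime_measure R n].
  have := @xgetPex _ (cst 0) [set f : spacetime R n -> R |
    Xspace p f /\ u = J alpha f %[ae spacetime_measure R n]].
  by apply; exists f0.
rewrite -/f in fu *.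
pose g z := `|f z|.
have mg : measurable_fun setT g by apply: measurableT_comp.
have fg : \forall z \ae spacetime_measure R n, f z = g z.
  by apply: filterS fu => z /andP[z0 _]; rewrite /g ger0_norm.
(* f and g agree almost everywhere, so this holds at every point z *)
have JU z : J alpha f z = fine (heat_potential alpha g z).
  rewrite /J /Rintegral; congr fine; apply: ae_eq_integral.
  - exact: measurable_past.
  - exact: measurable_heat_integrand.
  - exact: measurable_heat_integrand.
  - by apply: filterS fg => w -> _.
have U0 z : (0 <= heat_potential alpha g z)%E by apply: heat_potential_ge0 => w; rewrite /g.
have gae0 : \forall z \ae spacetime_measure R n, g z = 0.
  apply: (@heat_potential_power_uniqueness R n p alpha lambda g p1 l1 al mg).
  - by move=> w; rewrite /g.
  - move=> T; have := fp T; rewrite /finite_norm => /(@poweR_lty _ _ p).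
    rewrite powR_Lnorm ?gt_eqF//.
    rewrite (eq_integral (fun w => ((g w * \1_(past T) w) `^ p)%:E))//.
    by move=> w _; rewrite /= normrM [X in _ * X]ger0_norm.
  - apply: filterS3 fu uf fg => z /andP[_ fz] /(_ I) uz <-.
    apply: (@le_trans _ _ (u z `^ lambda)%:E); first by rewrite lee_fin.
    (* at points where the potential is infinite, the left side is 0^lambda = 0 *)
    rewrite uz JU; move: (U0 z); case: (heat_potential _ _ _) => //= _.
      by rewrite powR0 ?gt_eqF// leey.
  - apply: filterS3 fu uneg fg => z fz uz <- zneg; move: fz.
    rewrite uz// powR0 ?gt_eqF// => fz; apply/eqP; rewrite eq_le andbC.
    exact: fz.
have fae0 : \forall z \ae spacetime_measure R n, f z = 0.
  by apply: filterS2 fg gae0 => z ->.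
apply: filterS2 uf fae0 => z /(_ I) -> ->; split=> //.
rewrite JU /heat_potential (ae_eq_integral (cst 0%E)).
- by rewrite integral0.
- exact: measurable_past.
- exact: measurable_heat_integrand.
- exact: measurable_cst.
- by apply: filterS gae0 => w -> _; rewrite mulr0.
Qed.
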